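(* Nontrivial integer solutions $(a,p,q)$ of the Diophantine system $$\begin{cases}a^2+(p^2+q^2)^2=\square,\\ a^2+(p^2-q^2)^2=\square\end{cases}$$ are given by the formulas $$a=k\cdot 4N\sqrt{xz},\qquad p^2=k\cdot (x+N)(z-N),\qquad q^2=k\cdot (x-N)(z+N),$$ where $k$ is an integer and $x$ and $z$ are nontrivial different rational solutions of an arbitrary congruent number equation $C_N$. (The integer $k$ and the solutions $x,z$ must be chosen so that $a$, $p$ and $q$ are integers.)
   Context: The symbol $\square$ denotes a perfect square (not necessarily the same one at each occurrence). For a squarefree positive integer $N$, the congruent number equation is $C_N:\ y^2=x^3-N^2x$. A rational solution $(x,y)$ of $C_N$ is nontrivial if $y\neq 0$; its first coordinate is also called a nontrivial rational solution of $C_N$. Thus $x$ and $z$ are the first coordinates of nontrivial rational solutions of the same equation $C_N$. A solution of the system corresponds to two Pythagorean triangles with common leg $a=a_1=a_2$, other legs $b_1=p^2+q^2$, $b_2=p^2-q^2$ and hypotenuses $c_1,c_2$. The solution is called nontrivial if both Pythagorean triangles exist and they are distinct: $a_1b_1c_1a_2b_2c_2\neq 0$; $apq\neq 0$ and $p\neq q$.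
   Formalization: Not every nontrivial solution has an integer k (e.g. (1344,17,9) forces N=34, k=64/289 or -441/1156), so each one is shown to be given by the formulas only after scaling (a,p,q) to (t²a,tp,tq), t a positive integer, i.e. with rational k; k is taken nonzero. *)

(* Defs.v *)
From mathcomp Require Import all_boot all_order all_algebra all_field.

Set Implicit Arguments.
Unset Strict Implicit.
Unset Printing Implicit Defensive.

Import Order.TTheory GRing.Theory Num.Theory.
Local Open Scope ring_scope.

(* The legs are b1 = p^2 + q^2 and b2 = p^2 - q^2, the common leg is a, and the
   hypotenuses c1, c2 witness that the two sums are perfect squares.  The
   condition b2 != 0 also excludes p = - q. *)
Definition nontrivial_solution (a p q : int) : Prop :=
  let b1 := p ^+ 2 + q ^+ 2 in
  let b2 := p ^+ 2 - q ^+ 2 in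
  exists c1 c2 : int,
    [/\ a ^+ 2 + b1 ^+ 2 = c1 ^+ 2,
        a ^+ 2 + b2 ^+ 2 = c2 ^+ 2,
        a * b1 * c1 * a * b2 * c2 != 0,
        a * p * q != 0
      & p != q].

Definition squarefree (N : nat) : Prop :=
  forall d : nat, (d ^ 2 %| N)%N -> d = 1%N.

Definition nontrivial_congruent_solution (N : nat) (x : rat) : Prop :=
  exists2 y : rat, y != 0 & y ^+ 2 = x ^+ 3 - N%:R ^+ 2 * x.

(* The square root is taken in algC, where it is nonnegative on nonnegative
   rationals; being an equation with an integer a, the first formula forces
   x * z to be the square of a rational as soon as k and N are nonzero. *)
Definition solution_formulas (N : nat) (k : int) (x z : rat) (a p q : int) :
    Prop :=
  [/\ a%:~R = k%:~R * (4 * N%:R * sqrtC (ratr (x * z))) :> algC,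
      (p ^+ 2)%:~R = k%:~R * ((x + N%:R) * (z - N%:R)) :> rat
    & (q ^+ 2)%:~R = k%:~R * ((x - N%:R) * (z + N%:R)) :> rat].

(* k = 0 only yields (0, 0, 0).  Replacing k by t^2 k turns (a, p, q) into
   (t^2 a, t p, t q); some primitive triples, such as (1344, 17, 9), are reached
   with an integer k only after such a rescaling. *)
Definition given_by_formulas (a p q : int) : Prop :=
  exists (N : nat) (k : int) (x z : rat),
    [/\ (0 < N)%N /\ squarefree N,
        k != 0,
        nontrivial_congruent_solution N x /\ nontrivial_congruent_solution N z,
        x != z
      & solution_formulas N k x z a p q].

(* Main.v *)
Require Import Defs.
From mathcomp Require Import all_boot all_order all_algebra all_field.
From mathcomp Require Import ring.
Set Implicit Arguments.
Unset Strict Implicit.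
Unset Printing Implicit Defensive.

Import Order.TTheory GRing.Theory Num.Theory.
Local Open Scope ring_scope.

(** Both directions rest on the identities
      [(u + 1) * (v - 1) + (u - 1) * (v + 1) = 2 * (u * v - 1)],
      [(u + 1) * (v - 1) - (u - 1) * (v + 1) = 2 * (v - u)],
      [(u * v - 1) ^+ 2 + 4 * (u * v) = (u * v + 1) ^+ 2],
      [(v - u) ^+ 2 + 4 * (u * v) = (v + u) ^+ 2],
    taken at [u = x / N] and [v = z / N].

    From the formulas to the system, they exhibit the two hypotenuses as
    [2 * k * (x * z + N ^+ 2)] and [2 * k * N * (x + z)].  These are rational
    with integer squares, hence integers ([int_of_rat_sqrt]).

    Conversely, the two rational points on the conics [a^2 + b1^2 = c1^2] and
    [a^2 + b2^2 = c2^2] determine [u] and [v]:  with [K = c1 - b1], one takes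
    [u = (c2 - b2) / K] and [v = (c2 + b2) / K].  The definition of [p] and [q]
    then becomes [4 * p ^+ 2 = K * (u + 1) * (v - 1)] and
    [4 * q ^+ 2 = K * (u - 1) * (v + 1)], so that
      [(u ^+ 3 - u) * (v ^+ 3 - v) = (4 * (a * p * q) / K ^+ 2) ^+ 2]
    is a nonzero square: [u ^+ 3 - u] and [v ^+ 3 - v] have the same squarefree
    part, up to sign.  The signs of the hypotenuses are free.  That of [c1] is
    chosen so that [K] has the sign of [a], as the square root in the formula
    for [a] is nonnegative; changing that of [c2] replaces [(u, v)] with
    [(- v, - u)], so it can be chosen to make [u ^+ 3 - u] positive
    ([exists_hypotenuse2]).  If [N] is the squarefree part of [u ^+ 3 - u], then
    [x = N * u] and [z = N * v] are both on the curve [C_N], because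
    [x ^+ 3 - N ^+ 2 * x = N ^+ 2 * (N * (u ^+ 3 - u))].  Multiplying [p] and
    [q] by [2 * N] clears the denominator [4 * N ^+ 2] of [k = K / (4 * N ^+ 2)]. *)

(** * Squares and squarefree parts *)

(** The denominator of [c] is prime to its numerator, while its square divides
    that of the numerator. *)
Lemma int_of_rat_sqrt (c : rat) (m : int) :
  c ^+ 2 = m%:~R -> exists d : int, c = d%:~R.
Proof.
move=> c2m.
have num_den : numq c ^+ 2 = m * denq c ^+ 2.
  apply: (intr_inj (R := rat)); rewrite rmorphXn [in RHS]rmorphM rmorphXn /=.
  by rewrite -c2m -exprMn -numqE.
have den_dvd : (`|denq c| ^ 2 %| `|numq c| ^ 2)%N.
  by rewrite -!abszX num_den abszM dvdn_mull.
rewrite dvdn_pexp2r // in den_dvd.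
have den1 : `|denq c|%N = 1%N.
  apply/eqP; rewrite -dvdn1.
  by rewrite -(eqP (coprime_num_den c)) dvdn_gcd den_dvd dvdnn.
exists (numq c); rewrite numqE.
by rewrite -[denq c]gez0_abs ?denq_ge0 // den1 mulr1.
Qed.

Lemma squarefree_part_nat (m : nat) : (0 < m)%N ->
  exists N s : nat, [/\ (0 < N)%N, squarefree N, (0 < s)%N & m = (N * s ^ 2)%N].
Proof.
elim/ltn_ind: m => m IHm m_gt0.
have [/existsP[d /andP[d_neq1 /dvdnP[m' m_eq]]]|no_d] :=
    boolP [exists d : 'I_m.+1, (d != 1 :> nat) && (d ^ 2 %| m)%N].
  have d_gt0 : (0 < d)%N by rewrite lt0n; apply/eqP=> d0; rewrite m_eq d0 muln0 in m_gt0.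
  have m'_gt0 : (0 < m')%N by rewrite lt0n; apply/eqP=> m'0; rewrite m_eq m'0 in m_gt0.
  have d_gt1 : (1 < d)%N by rewrite ltn_neqAle eq_sym d_neq1.
  have m'_lt : (m' < m)%N by rewrite m_eq ltn_Pmulr // (ltn_exp2l 0).
  have [N [s [N_gt0 sfN s_gt0 m'_eq]]] := IHm m' m'_lt m'_gt0.
  exists N, (s * d)%N; split=> //; first by rewrite muln_gt0 s_gt0.
  by rewrite expnMn mulnA -m'_eq.
exists m, 1%N; split=> // [d d2m|]; last by rewrite muln1.
have d_le : (d < m.+1)%N.
  rewrite ltnS (leq_trans _ (dvdn_leq m_gt0 d2m)) //.
  by case: (d) => // e; rewrite -[X in (X <= _)%N]expn1 leq_pexp2l.
apply/eqP; apply: contraNT no_d => d_neq1.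
by apply/existsP; exists (Ordinal d_le); rewrite /= d_neq1.
Qed.

Lemma squarefree_part_rat (w : rat) : 0 < w ->
  exists N : nat, [/\ (0 < N)%N, squarefree N
    & exists2 y : rat, y != 0 & y ^+ 2 = N%:R * w].
Proof.
move=> w_gt0.
have num_gt0 : (0 < `|numq w|)%N by rewrite absz_gt0 gt_eqF // numq_gt0.
have den_gt0 : (0 < `|denq w|)%N by rewrite absz_gt0 denq_neq0.
have [|N [s [N_gt0 sfN s_gt0 ms]]] := squarefree_part_nat (m := `|numq w| * `|denq w|).
  by rewrite muln_gt0 num_gt0.
have absN (i : int) : 0 <= i -> (`|i|%N)%:R = i%:~R :> rat.
  by move=> i_ge0; rewrite -[in RHS](gez0_abs i_ge0).
have d0 : (denq w)%:~R != 0 :> rat by rewrite intr_eq0 denq_neq0.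
(* A fraction has the squarefree part of the product of its two terms. *)
have w_eq : w * (denq w)%:~R ^+ 2 = N%:R * s%:R ^+ 2.
  rewrite -natrX -natrM -ms natrM !absN ?denq_ge0 ?numq_ge0 ?ltW //.
  by rewrite numqE; ring.
have N0 : N%:R != 0 :> rat by rewrite pnatr_eq0 -lt0n.
have s0 : s%:R != 0 :> rat by rewrite pnatr_eq0 -lt0n.
exists N; split=> //; exists (N%:R * s%:R / (denq w)%:~R).
  by rewrite !mulf_neq0 ?invr_neq0.
have wE : w = N%:R * s%:R ^+ 2 / (denq w)%:~R ^+ 2.
  by rewrite -w_eq mulfK // expf_neq0.
by rewrite [in RHS]wE; field.
Qed.

(** * From the formulas to the system *)

Lemma congruent_solution_neq0 (N : nat) (x : rat) :
  nontrivial_congruent_solution N x ->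
  [/\ x != 0, x - N%:R != 0 & x + N%:R != 0].
Proof.
case=> y y0 y2.
have: x * (x - N%:R) * (x + N%:R) != 0.
  have -> : x * (x - N%:R) * (x + N%:R) = y ^+ 2 by rewrite y2; ring.
  exact: expf_neq0.
by rewrite !mulf_eq0 !negb_or => /andP[/andP[]].
Qed.

Lemma formulas_nontrivial (a p q : int) :
  given_by_formulas a p q -> nontrivial_solution a p q.
Proof.
case=> N [k [x [z [[N_gt0 _] k0 [Cx Cz] xz [aE pE qE]]]]].
have [x0 xmN xpN] := congruent_solution_neq0 Cx.
have [z0 zmN zpN] := congruent_solution_neq0 Cz.
have kQ : k%:~R != 0 :> rat by rewrite intr_eq0.
have NQ : N%:R != 0 :> rat by rewrite pnatr_eq0 -lt0n.
have a2 : (a%:~R) ^+ 2 = 16 * k%:~R ^+ 2 * N%:R ^+ 2 * (x * z) :> rat.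
  (* Squaring makes the formula rational, so that it descends from [algC]. *)
  apply: (fmorph_inj (ratr : {rmorphism rat -> algC})).
  rewrite rmorphXn /= ratr_int aE !(rmorphM, rmorphXn) /= ratr_int !ratr_nat.
  by rewrite !exprMn sqrtCK; ring.
rewrite rmorphXn /= in pE; rewrite rmorphXn /= in qE.
have c1E : (2 * k%:~R * (x * z + N%:R ^+ 2)) ^+ 2
    = (a ^+ 2 + (p ^+ 2 + q ^+ 2) ^+ 2)%:~R :> rat.
  by rewrite !(rmorphD, rmorphXn) /= pE qE a2; ring.
have c2E : (2 * k%:~R * N%:R * (x + z)) ^+ 2
    = (a ^+ 2 + (p ^+ 2 - q ^+ 2) ^+ 2)%:~R :> rat.
  by rewrite !(rmorphB, rmorphD, rmorphXn) /= pE qE a2; ring.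
have [c1 c1Q] := int_of_rat_sqrt c1E.
have [c2 c2Q] := int_of_rat_sqrt c2E.
rewrite c1Q -rmorphXn /= in c1E; rewrite c2Q -rmorphXn /= in c2E.
move/intr_inj: c1E => c1E; move/intr_inj: c2E => c2E.
have a0 : a != 0.
  by rewrite -(intr_eq0 rat) -sqrf_eq0 a2 !mulf_neq0 ?expf_neq0.
have p0 : p != 0 by rewrite -(intr_eq0 rat) -sqrf_eq0 pE !mulf_neq0.
have q0 : q != 0 by rewrite -(intr_eq0 rat) -sqrf_eq0 qE !mulf_neq0.
have a2_gt0 : 0 < a ^+ 2 by rewrite exprn_even_gt0.
have b10 : p ^+ 2 + q ^+ 2 != 0.
  by rewrite gt_eqF // addr_gt0 // exprn_even_gt0.
have b20 : p ^+ 2 - q ^+ 2 != 0.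
  rewrite -(intr_eq0 rat) rmorphB !rmorphXn /= pE qE.
  have -> : k%:~R * ((x + N%:R) * (z - N%:R)) - k%:~R * ((x - N%:R) * (z + N%:R))
      = 2 * k%:~R * N%:R * (z - x) by ring.
  by rewrite !mulf_neq0 // subr_eq0 eq_sym.
have hyp_neq0 (b c : int) : c ^+ 2 = a ^+ 2 + b ^+ 2 -> c != 0.
  by move=> cE; rewrite -sqrf_eq0 cE gt_eqF // ltr_wpDr // sqr_ge0.
exists c1, c2; split=> //.
- by rewrite !mulf_neq0 // ?(hyp_neq0 _ _ c1E) ?(hyp_neq0 _ _ c2E).
- by rewrite !mulf_neq0.
- by apply: contraNneq b20 => ->; rewrite subrr.
Qed.

(** * From the system to the formulas *)

(** The inverse parametrisation.  Here [K] stands for [c1 - b1], so that the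
    first hypothesis is [a^2 + b1^2 = c1^2] once [c1] is eliminated. *)
Section InverseParametrisation.

Variables (F : fieldType) (a p q c2 K : F).
Hypothesis K0 : K != 0.
Hypothesis hyp1 : a ^+ 2 = K * (K + 2 * (p ^+ 2 + q ^+ 2)).
Hypothesis hyp2 : a ^+ 2 + (p ^+ 2 - q ^+ 2) ^+ 2 = c2 ^+ 2.

Let u := (c2 - (p ^+ 2 - q ^+ 2)) / K.
Let v := (c2 + (p ^+ 2 - q ^+ 2)) / K.

Lemma param_mul : u * v = (a / K) ^+ 2.
Proof.
have -> : u * v = (c2 ^+ 2 - (p ^+ 2 - q ^+ 2) ^+ 2) / K ^+ 2.
  by rewrite /u /v; field.
by rewrite -hyp2 addrK expr_div_n.
Qed.

Lemma param_p : 4 * p ^+ 2 = K * ((u + 1) * (v - 1)).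
Proof.
have -> : (u + 1) * (v - 1) = u * v + (v - u) - 1 by ring.
by rewrite param_mul expr_div_n hyp1 /u /v; field.
Qed.

Lemma param_q : 4 * q ^+ 2 = K * ((u - 1) * (v + 1)).
Proof.
have -> : (u - 1) * (v + 1) = u * v - (v - u) - 1 by ring.
by rewrite param_mul expr_div_n hyp1 /u /v; field.
Qed.

Lemma param_cubics :
  (u ^+ 3 - u) * (v ^+ 3 - v) = (4 * (a * p * q) / K ^+ 2) ^+ 2.
Proof.
have -> : (u ^+ 3 - u) * (v ^+ 3 - v) =
    u * v * ((K * ((u + 1) * (v - 1))) * (K * ((u - 1) * (v + 1)))) / K ^+ 2.
  by field.
by rewrite -param_p -param_q param_mul; field.
Qed.

End InverseParametrisation.

(** The formula for [a] gives it the sign of [k], hence of [c1 - b1]; since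
    [b < `|c|], the sign of [c - b] is that of [c], which is free. *)
Lemma exists_hypotenuse1 (a b c : int) : a != 0 -> 0 < b ->
  a ^+ 2 + b ^+ 2 = c ^+ 2 ->
  exists2 c1 : int, a ^+ 2 + b ^+ 2 = c1 ^+ 2 & 0 < a * (c1 - b).
Proof.
move=> a0 b_gt0 abc.
have b_lt : b < `|c|.
  rewrite -(ltr_pXn2r (n := 2)) ?nnegrE ?normr_ge0 ?ltW //.
  by rewrite real_normK ?num_real // -abc ltrDr exprn_even_gt0.
have [a_lt0|a_gt0|a_eq0] := ltgtP a 0; last by rewrite a_eq0 eqxx in a0.
  exists (- `|c|); first by rewrite sqrrN real_normK ?num_real.
  by rewrite nmulr_rgt0 // subr_lt0 (le_lt_trans _ b_gt0) // oppr_le0.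
exists `|c|; first by rewrite real_normK ?num_real.
by rewrite pmulr_rgt0 // subr_gt0.
Qed.

(** Since [N] is positive, it can be the squarefree part of [u ^+ 3 - u] only
    if this cubic is positive.  By [param_cubics] the cubics at [u] and [v] have
    the same sign, and exchanging [u] with [- v] reverses it. *)
Lemma exists_hypotenuse2 (F : realFieldType) (a p q c K : F) :
    a * p * q != 0 -> K != 0 ->
    a ^+ 2 = K * (K + 2 * (p ^+ 2 + q ^+ 2)) ->
    a ^+ 2 + (p ^+ 2 - q ^+ 2) ^+ 2 = c ^+ 2 ->
  exists2 c2 : F, c2 ^+ 2 = c ^+ 2 &
    0 < ((c2 - (p ^+ 2 - q ^+ 2)) / K) ^+ 3 - (c2 - (p ^+ 2 - q ^+ 2)) / K.
Proof.
move=> apq0 K0 hyp1 hyp2.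
have := param_cubics K0 hyp1 hyp2.
set u := (c - _) / K; set v := (c + _) / K => uv.
have uv_gt0 : 0 < (u ^+ 3 - u) * (v ^+ 3 - v).
  rewrite uv exprn_even_gt0 //= mulf_neq0 ?invr_neq0 ?expf_neq0 //.
  by rewrite mulf_neq0 ?pnatr_eq0.
have [u_gt0|u_le0] := ltP 0 (u ^+ 3 - u); first by exists c.
exists (- c); first by rewrite sqrrN.
(* Changing the sign of [c] turns [u] into [- v], and the cubic is odd. *)
have -> : (- c - (p ^+ 2 - q ^+ 2)) / K = - v by rewrite /v -opprD mulNr.
have -> : (- v) ^+ 3 - (- v) = - (v ^+ 3 - v) by ring.
rewrite oppr_gt0; rewrite ltNge; apply/negP=> v_ge0.
by move: uv_gt0; rewrite ltNge mulr_le0_ge0.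
Qed.

Lemma nontrivial_formulas (a p q : int) : nontrivial_solution a p q ->
  exists2 t : int, 0 < t & given_by_formulas (t ^+ 2 * a) (t * p) (t * q).
Proof.
case=> c [c' [abc abc' nz apq0 _]].
have [a0 p0 q0] : [/\ a != 0, p != 0 & q != 0].
  by move: apq0; rewrite !mulf_eq0 !negb_or => /andP[/andP[]].
have b20 : p ^+ 2 - q ^+ 2 != 0.
  by move: nz; rewrite !mulf_eq0 !negb_or => /andP[/andP[_ ->]].
have b1_gt0 : 0 < p ^+ 2 + q ^+ 2 by rewrite addr_gt0 // exprn_even_gt0.
have [c1 abc1 aK_gt0] := exists_hypotenuse1 a0 b1_gt0 abc.
set K := c1 - _ in aK_gt0.
have K0 : K != 0 by apply: contraTneq aK_gt0 => ->; rewrite mulr0 ltxx.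
have KQ : K%:~R != 0 :> rat by rewrite intr_eq0.
pose A : rat := a%:~R; pose P : rat := p%:~R; pose Q : rat := q%:~R.
have hyp1 : A ^+ 2 = K%:~R * (K%:~R + 2 * (P ^+ 2 + Q ^+ 2)).
  rewrite /A /P /Q -!rmorphXn -rmorphD -[2]/(2%:~R) -rmorphM -rmorphD -rmorphM.
  congr (_%:~R); rewrite -[LHS](addrK ((p ^+ 2 + q ^+ 2) ^+ 2)) abc1 /K.
  by ring.
have hyp' : A ^+ 2 + (P ^+ 2 - Q ^+ 2) ^+ 2 = c'%:~R ^+ 2.
  by rewrite /A /P /Q -!(rmorphXn, rmorphB, rmorphD) /= abc'.
have APQ : A * P * Q != 0 by rewrite -!rmorphM intr_eq0.
have [c2 c2E u_gt0] := exists_hypotenuse2 APQ KQ hyp1 hyp'.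
have hyp2 : A ^+ 2 + (P ^+ 2 - Q ^+ 2) ^+ 2 = c2 ^+ 2 by rewrite c2E.
have uvE := param_mul KQ hyp2.
have pE := param_p KQ hyp1 hyp2.
have qE := param_q KQ hyp1 hyp2.
have cubE := param_cubics KQ hyp1 hyp2.
have vBu : (c2 + (P ^+ 2 - Q ^+ 2)) / K%:~R - (c2 - (P ^+ 2 - Q ^+ 2)) / K%:~R
    = 2 * (P ^+ 2 - Q ^+ 2) / K%:~R by field.
move: uvE pE qE cubE u_gt0 vBu.
set u := (c2 - _) / _; set v := (c2 + _) / _ => uvE pE qE cubE u_gt0 vBu.
have [N [N_gt0 sfN [y y0 yE]]] := squarefree_part_rat u_gt0.
have NQ : N%:R != 0 :> rat by rewrite pnatr_eq0 -lt0n.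
exists (2 * N%:Z); first by rewrite mulr_gt0.
exists N, K, (N%:R * u), (N%:R * v); split=> //.
- split.
    by exists (N%:R * y); [rewrite mulf_neq0 | rewrite exprMn yE; ring].
  (* The cubic at [v] is a square times the inverse of the cubic at [u]. *)
  set r := 4 * (A * P * Q) / _ in cubE.
  have r0 : r != 0 by rewrite mulf_neq0 ?invr_neq0 ?expf_neq0 // mulf_neq0.
  exists (N%:R ^+ 2 * r / y).
    by rewrite mulf_neq0 ?invr_neq0 // mulf_neq0 ?expf_neq0.
  rewrite expr_div_n exprMn -cubE yE.
  have w0 : u ^+ 3 - u != 0 by rewrite gt_eqF.
  by field; rewrite w0.
- apply: contraNneq b20 => /(mulfI NQ) uv; move/esym/eqP: vBu.
  rewrite uv subrr !mulf_eq0 invr_eq0 (negPf KQ) orbF pnatr_eq0 /=.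
  by rewrite -!rmorphXn -rmorphB intr_eq0.
- have tQ : (2 * N%:Z)%:~R = 2 * N%:R :> rat by rewrite rmorphM.
  split.
  + have AK_ge0 : 0 <= N%:R * (A / K%:~R).
      rewrite mulr_ge0 // -[A / _](mulfK (expf_neq0 2 KQ)).
      rewrite divr_ge0 ?sqr_ge0 //.
      have -> : A / K%:~R * K%:~R ^+ 2 = A * K%:~R by field.
      by rewrite -rmorphM ler0z ltW.
    have -> : N%:R * u * (N%:R * v) = (N%:R * (A / K%:~R)) ^+ 2.
      by rewrite exprMn -uvE; ring.
    rewrite rmorphXn /= sqrCK ?ler0q //.
    rewrite -[LHS]ratr_int -[K%:~R in RHS]ratr_int -[N%:R in RHS]ratr_nat.
    rewrite -[4]ratr_nat -!rmorphM /=; congr ratr.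
    by rewrite rmorphM rmorphXn /= tQ -/A; field.
  + rewrite rmorphXn rmorphM /= tQ -/P.
    have -> : K%:~R * ((N%:R * u + N%:R) * (N%:R * v - N%:R))
      = N%:R ^+ 2 * (K%:~R * ((u + 1) * (v - 1))) by ring.
    by rewrite -pE; ring.
  + rewrite rmorphXn rmorphM /= tQ -/Q.
    have -> : K%:~R * ((N%:R * u - N%:R) * (N%:R * v + N%:R))
      = N%:R ^+ 2 * (K%:~R * ((u - 1) * (v + 1))) by ring.
    by rewrite -qE; ring.
Qed.

Theorem theorem3 :
  (forall a p q : int, given_by_formulas a p q -> nontrivial_solution a p q)
  /\
  (forall a p q : int, nontrivial_solution a p q ->
     exists2 t : int, 0 < t & given_by_formulas (t ^+ 2 * a) (t * p) (t * q)).
Proof. by split; [exact: formulas_nontrivial | exact: nontrivial_formulas]. Qed.
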